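(* Let $\mathcal{I}$ be an ideal on $\omega$ such that there are pairwise disjoint subsets $(B_j)_{j\in\omega}$ of $\omega$ with $B_j\notin\mathcal{I}$ for every $j\in\omega$. Then both $\Gamma(\mathcal{I},\omega)$ and $\Gamma(\mathcal{I},\mathfrak{c})$ are densely lineable in $\ell_\infty$ and spaceable in $\ell_\infty$.
   Context: $\ell_\infty$ is the real Banach space of bounded real sequences $x=(x(n))_{n\in\omega}$ with the supremum norm, where $\omega=\{0,1,2,\dots\}$ (also denoting the smallest infinite cardinal); $\mathfrak{c}$ is the cardinality of the continuum. An ideal $\mathcal{I}$ on $\omega$ is a proper subfamily of $\mathcal{P}(\omega)$ which is closed under subsets and finite unions and contains all singletons of $\omega$. For $x\in\ell_\infty$, $\Gamma_x(\mathcal{I})$ is the set of $\mathcal{I}$-cluster points of $x$, i.e. the set of all $\eta\in\mathbb{R}$ such that $\{n\in\omega:|x(n)-\eta|<\varepsilon\}\notin\mathcal{I}$ for all $\varepsilon>0$. For a cardinal $\kappa$, $\Gamma(\mathcal{I},\kappa)=\{x\in\ell_\infty: |\Gamma_x(\mathcal{I})|=\kappa\}$. A subset $M$ of a topological vector space $X$ is densely lineable in $X$ if $M\cup\{0\}$ contains a linear subspace that is dense in $X$; it is spaceable in $X$ if $M\cup\{0\}$ contains a closed infinite-dimensional linear subspace of $X$. *)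

(* Defs.v *)
From HB Require Import structures.
From mathcomp Require Import all_boot all_order all_algebra.
From mathcomp Require Import all_classical all_reals all_analysis.
From mathcomp Require Import lra.

Set Implicit Arguments.
Unset Strict Implicit.
Unset Printing Implicit Defensive.

Import Order.TTheory GRing.Theory Num.Theory.
Import numFieldNormedType.Exports.

Local Open Scope classical_set_scope.
Local Open Scope card_scope.
Local Open Scope ring_scope.

Section linf.
Context {R : realType}.

Definition bounded_seq : {pred nat -> R} := mem (bounded_fun : set (nat -> R)).

Record linf := Linf {
  linf_val :> nat -> R ;
  linf_valP : linf_val \in bounded_seq }.

HB.instance Definition _ := [isSub for linf_val].
HB.instance Definition _ := [Choice of linf by <:].

Lemma bounded_seqP (x : nat -> R) :
  x \in bounded_seq <-> exists M : R, forall n, `|x n| <= M.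
Proof.
have setTF := @globally_properfilter _ setT 0%N I.
rewrite inE; split=> [/(@ex_bound _ _ _ _ _ setTF)[M xM]|[M xM]].
  by exists M => n; exact: xM.
by apply/(@ex_bound _ _ _ _ _ setTF); exists M => n _; exact: xM.
Qed.

Lemma bounded_seq_submod_closed : submod_closed bounded_seq.
Proof.
split=> [|a x y /bounded_seqP[M xM] /bounded_seqP[N yN]]; apply/bounded_seqP.
  by exists 0 => n; rewrite normr0.
exists (`|a| * M + N) => n; rewrite (le_trans (ler_normD _ _))//.
by rewrite lerD// normrM ler_wpM2l.
Qed.

HB.instance Definition _ :=
  GRing.isSubmodClosed.Build _ _ bounded_seq bounded_seq_submod_closed.
HB.instance Definition _ := [SubChoice_isSubLmodule of linf by <:].

Definition sup_norm (x : linf) : R := sup (range (fun n => `|x n|)).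

Lemma has_sup_linf (x : linf) : has_sup (range (fun n => `|x n|)).
Proof.
split; first by exists `|x 0%N|, 0%N.
have /bounded_seqP[M xM] := linf_valP x.
by exists M => _ [n _ <-].
Qed.

Lemma le_sup_norm (x : linf) n : `|x n| <= sup_norm x.
Proof. by apply: (ub_le_sup (has_sup_linf x).2); exists n. Qed.

Lemma sup_norm_le (x : linf) (M : R) :
  (forall n, `|x n| <= M) -> sup_norm x <= M.
Proof.
by move=> xM; apply: (ge_sup (has_sup_linf x).1) => _ [n _ <-].
Qed.

Lemma ler_sup_normD (x y : linf) : sup_norm (x + y) <= sup_norm x + sup_norm y.
Proof.
apply: sup_norm_le => n.
by rewrite (le_trans (ler_normD _ _))// lerD ?le_sup_norm.
Qed.

Lemma sup_norm_eq0 (x : linf) : sup_norm x = 0 -> x = 0.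
Proof.
move=> x0; apply/val_inj/funext => n; apply/eqP.
by rewrite -normr_le0 -x0 le_sup_norm.
Qed.

Lemma sup_normZ (a : R) (x : linf) : sup_norm (a *: x) = `|a| * sup_norm x.
Proof.
apply/le_anti/andP; split.
  by apply: sup_norm_le => n; rewrite normrM ler_wpM2l ?le_sup_norm.
have [->|a0] := eqVneq a 0.
  by rewrite normr0 mul0r (le_trans _ (le_sup_norm _ 0%N)).
rewrite -ler_pdivlMl ?normr_gt0//; apply: sup_norm_le => n.
by rewrite ler_pdivlMl ?normr_gt0// -normrM (le_sup_norm (a *: x)).
Qed.

HB.instance Definition _ :=
  Lmodule_isNormed.Build R linf ler_sup_normD sup_normZ sup_norm_eq0.

Lemma linf_normE (x : linf) : `|x| = sup (range (fun n => `|x n|)).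
Proof. by []. Qed.

Lemma linf_cauchy_cvg (F : set_system linf) :
  ProperFilter F -> cauchy F -> cvg F.
Proof.
move=> FF /cauchyP Fc0.
have Fc (e : R) : 0 < e ->
    exists x : linf, F [set y : linf | forall n, `|x n - y n| < e].
  move=> e0; have [x Fx] := Fc0 _ e0; exists x.
  apply: (@filterS _ F _ (ball x e)) => // y.
  rewrite -ball_normE/= => + n; apply: le_lt_trans.
  exact: (le_sup_norm (x - y)).
have coord n : cvg ((fun x : linf => x n) @ F).
  apply/cauchy_cvgP/cauchyP => e e0.
  have [x Fx] := Fc _ e0; exists (x n).
  rewrite -ball_normE.
  by apply: (@filterS _ F _ _ _ _ Fx) => y; exact.
pose l n : R := lim ((fun x : linf => x n) @ F).
have close (e : R) : 0 < e -> exists x : linf,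
    F [set y : linf | forall n, `|x n - y n| < e] /\
    forall n, `|x n - l n| <= e.
  move=> e0; have [x Fx] := Fc _ e0; exists x.
  split=> // n.
  have xy_cvg : `|x n - y n| @[y --> F] --> `|x n - l n|.
    by apply: cvg_norm; apply: cvgB; [exact: cvg_cst|exact: coord].
  apply: (closed_cvg (fun r : R => r <= e) _ _ _ xy_cvg).
    exact: closed_le.
  by apply: (@filterS _ F _ _ _ _ Fx) => y /(_ n) /ltW.
have lb : l \in bounded_seq.
  have [x [_ xl]] := close _ ltr01.
  apply/bounded_seqP; exists (sup_norm x + 1) => n.
  rewrite -[l n](subKr (x n)) (le_trans (ler_normB _ _))//.
  by rewrite lerD ?le_sup_norm.
apply/cvg_ex; exists (Linf lb); apply/cvgrPdist_lt => e e0.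
have e3 : 0 < e / 3 by rewrite divr_gt0.
have [x [Fx xl]] := close _ e3.
apply: (@filterS _ F _ _ _ _ Fx) => y xy.
apply: (@le_lt_trans _ _ (e / 3 + e / 3)); last by lra.
apply: sup_norm_le => n.
have -> : (Linf lb - y) n = (x n - y n) - (x n - l n).
  by rewrite opprB [RHS]addrC addrA subrK.
rewrite (le_trans (ler_normB _ _))// lerD//.
by apply: ltW; exact: xy.
Qed.

HB.instance Definition _ := Uniform_isComplete.Build linf linf_cauchy_cvg.

End linf.
Arguments linf : clear implicits.

(* Closure under binary unions suffices: the empty union set0 is in I since it
   is a subset of a singleton. *)
Record is_ideal (I : set (set nat)) : Prop := IsIdeal {
  ideal_proper : I <> [set: set nat] ;
  ideal_sub : forall A B, A `<=` B -> I B -> I A ;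
  ideal_setU : forall A B, I A -> I B -> I (A `|` B) ;
  ideal_set1 : forall n, I [set n] }.

Definition cluster_points (R : realType) (I : set (set nat)) (x : nat -> R) :
    set R :=
  [set eta | forall eps : R, 0 < eps -> ~ I [set n | `|x n - eta| < eps]].

(* The cardinal kappa is represented by a set K of that cardinality: [set: nat]
   for omega, [set: R] for the continuum. *)
Definition Gamma (R : realType) (I : set (set nat)) (T : Type) (K : set T) :
    set (linf R) :=
  [set x | cluster_points I x #= K].
Arguments Gamma R I {T} K.

Section lineability.
Context {R : realType} {X : topologicalLmodType R}.

Definition finite_dimensional (V : set X) : Prop :=
  exists (n : nat) (b : 'I_n -> X),
    V = [set v | exists c : 'I_n -> R, v = \sum_(i < n) c i *: b i].

Definition densely_lineable (M : set X) : Prop :=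
  exists V : set X,
    [/\ submod_closed (mem V), dense V & V `<=` M `|` [set 0]].

Definition spaceable (M : set X) : Prop :=
  exists V : set X,
    [/\ submod_closed (mem V), closed V, ~ finite_dimensional V &
        V `<=` M `|` [set 0]].

End lineability.

(* Main.v *)
(** Indexing infinitely many of the given positive sets by [nat * nat]
    yields [h, k : nat -> nat] all of whose fibers [{h = i, k = l}] are
    outside the ideal.  For a fixed bounded [q] attaining the value 1, the
    sequences [a (h n) * q (k n)] with [a] null form a closed
    infinite-dimensional subspace [W] of [l_oo].  When [w] is a nonzero element
    of [W], some [a i] is nonzero, so every [a i * q l] is a cluster point of
    [w].  With [q l = 1 / (l + 1)] the cluster points are infinite in number
    and lie in a countable closed set; with [q] enumerating the rationals of
    [[-1, 1]] they contain an interval.  This gives spaceability.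

    Both properties survive the addition of a sequence [s] of finite range,
    up to a shift by one of the finitely many values of [s]; for the interval,
    one uses that if finitely many closed sets cover an interval then one of
    them contains an interval.  Dense lineability follows from the span of
    the vectors [1_A + w_(A, m)], where the [w_(A, m)] in [W] are linearly
    independent with [|w_(A, m)| <= 1 / (m + 1)]: letting [m] tend to infinity
    recovers every indicator function, and these span a dense subspace.
    Linear independence comes from an almost disjoint family. *)

Require Import Defs.
From mathcomp Require Import all_boot all_order all_algebra.
From mathcomp Require Import all_classical all_reals all_analysis.
From mathcomp Require Import ring lra.
Import Order.TTheory GRing.Theory Num.Theory.
Import numFieldNormedType.Exports.
Local Open Scope classical_set_scope.
Local Open Scope ring_scope.

(** * Intervals of the real line: cardinality and finite closed covers *)

Section real_line.
Context {R : realType}.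
Implicit Types (a b : R).

(** The rescaled arctangent [f] maps the whole line injectively into the interval from [a] to [b],
    so [g \o f] embeds the line in [A]. *)
Lemma itv_inj_card_le {T : Type} (A : set T) (g : R -> T) a b : a < b ->
  injective g -> (forall t, a < t < b -> A (g t)) -> ([set: R] #<= A)%card.
Proof.
move=> ab g_inj gA.
pose f t := (a + b) / 2 + (b - a) / pi * @atan R t.
have pi0 := pi_gt0 R.
have gf_inj : injective (g \o f).
  move=> x y /= /g_inj /addrI /mulfI.
  move=> /(_ _)/(can_inj (@atanK R)) -> //.
  by rewrite mulf_neq0 ?invr_neq0 ?gt_eqF// subr_gt0.
have /card_eqPle[_ gfT] := inj_card_eq (A := [set: R]) (in2W gf_inj).
apply: card_le_trans gfT _; apply: subset_card_le => _ [t _ <-] /=.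
apply: gA.
have := atan_gtNpi2 t; have := atan_ltpi2 t.
have -> : f t = (a + b) / 2 + (b - a) * (atan t / pi).
  by rewrite /f -!mulrA [pi^-1 * _]mulrC.
rewrite -[pi / 2]mulrC -ltr_pdivrMr// => h1; rewrite -mulNr -ltr_pdivlMr// => h2.
by nra.
Qed.

(** By induction on [s]: if [C t] misses a point of the interval, then, being closed, it misses a
    whole subinterval, which the remaining sets must cover. *)
Lemma closed_cover_itv {T : eqType} (s : seq T) (C : T -> set R) a b : a < b ->
  (forall t, t \in s -> closed (C t)) ->
  (forall x, a < x < b -> exists2 t, t \in s & C t x) ->
  exists2 t, t \in s &
    exists c d, c < d /\ forall x, c < x < d -> C t x.
Proof.
elim: s a b => [|t s IH] a b ab cl cov.
  by have [|//] := cov ((a + b) / 2); lra.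
have [abC|] := pselect (forall x, a < x < b -> C t x).
  by exists t; [rewrite mem_head|exists a, b].
move=> /existsNP[x /not_implyP[/andP[ax xb] nCx]].
have := cl t (mem_head _ _); rewrite -openC => /open_subball => /(_ x nCx).
move=> [e /= e0 eC].
have [e' [e'0 e'e e'a e'b]] :
    exists e', [/\ 0 < e', e' < e, e' <= x - a & e' <= b - x].
  exists (Num.min (e / 2) (Num.min (x - a) (b - x))).
  by rewrite !lt_min !gt_min !ge_min; split; lra.
have cx : x - e' < x + e' by lra.
have [||u us [c [d [cd cdu]]]] := IH _ _ cx.
- by move=> u us; apply: cl; rewrite inE us orbT.
- move=> y yx; have [|u + Cuy] := cov y; first by lra.
  rewrite inE => /orP[/eqP ut|us]; last by exists u.
  rewrite ut in Cuy; exfalso; apply: (eC e' _ e'0 y _ Cuy).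
    by rewrite /ball_ /= sub0r normrN gtr0_norm.
  by rewrite -ball_normE/= ltr_norml; lra.
- by exists u; [rewrite inE us orbT|exists c, d].
Qed.

End real_line.

(** * Cluster points along an ideal *)

Section ideals.
Context {R : realType} {I : set (set nat)} (hI : is_ideal I).
Implicit Types (x s : nat -> R).

Lemma ideal_set0 : I set0.
Proof. by apply: (ideal_sub hI) (ideal_set1 hI 0%N). Qed.

Lemma ideal_bigcup_seq {T : eqType} (r : seq T) (A : T -> set nat) :
  (forall t, t \in r -> I (A t)) -> I [set n | exists2 t, t \in r & A t n].
Proof.
elim: r => [|t r IH] rA.
  by apply: (ideal_sub hI) ideal_set0 => n [].
apply: (ideal_sub hI) (ideal_setU hI (rA t (mem_head _ _)) (IH _)).
  move=> n [u]; rewrite inE => /orP[/eqP ->|ur] Aun; first by left.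
  by right; exists u.
by move=> u ur; apply: rA; rewrite inE ur orbT.
Qed.

Lemma closed_cluster_points x : closed (cluster_points I x).
Proof.
move=> eta clx e e0 Ie.
have e20 : 0 < e / 2 by lra.
have [y [Gy]] := clx _ (nbhsx_ballx eta _ e20).
rewrite -ball_normE/= => ye.
apply: (Gy _ e20); apply: (ideal_sub hI) Ie => n /= xny.
rewrite -(subrK y (x n)) -addrA (le_lt_trans (ler_normD _ _))//.
by rewrite -[y - eta]opprB normrN; lra.
Qed.

(** A point outside the closed set has a neighbourhood that [x] never enters, and the empty set
    belongs to [I]. *)
Lemma cluster_points_sub x (C : set R) : closed C -> (forall n, C (x n)) ->
  cluster_points I x `<=` C.
Proof.
move=> clC Cx eta Geta; apply: clC => A /nbhs_ballP[e /= e0 eA].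
apply: contrapT => CA; apply: (Geta _ e0); apply: (ideal_sub hI) ideal_set0.
move=> n xn; apply: CA; exists (x n); split => //; apply: eA.
by rewrite -ball_normE/= distrC.
Qed.

(** The level sets of [s] cut [P] into finitely many pieces. One of them is outside [I], and [x] is
    constant on it. *)
Lemma cluster_points_shift x s (P : set nat) (r : seq R) c :
  ~ I P -> (forall n, s n \in r) -> (forall n, P n -> x n = c + s n) ->
  exists2 v, v \in r & cluster_points I x (c + v).
Proof.
move=> nIP sr xP; apply: contrapT => nv; apply: nIP.
have /(ideal_sub hI) : I [set n | exists2 v, v \in r & P n /\ s n = v].
  apply: (@ideal_bigcup_seq _ r (fun v => P `&` [set n | s n = v])).
  move=> v vr; apply: contrapT => nI; apply: nv; exists v => // e e0.
  apply: contra_not nI; apply: (ideal_sub hI) => n [Pn /= sv].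
  by rewrite (xP _ Pn) sv subrr normr0.
by apply=> n Pn; exists (s n).
Qed.

End ideals.

(** * Products of two null sequences *)

Section products.
Context {R : realType}.
Implicit Types a b : nat -> R.

Lemma cvg0_bound {V : normedModType R} (u : nat -> V) :
  u @ \oo --> 0 -> exists2 M : R, 0 < M & forall n, `|u n| <= M.
Proof.
move=> /cvgP/cvg_seq_bounded/pinfty_ex_gt0[M M0 uM].
by exists M => // n; exact: uM.
Qed.

(** Zero is the only possible accumulation point: outside a finite grid of indices the products are
    at most [d], half of [|eta|], so a nonzero [eta] in the closure must be one of the finitely many
    products in the grid. *)
Lemma closed_products a b : a @ \oo --> 0 -> b @ \oo --> 0 ->
  closed ([set 0] `|` range (fun p : nat * nat => a p.1 * b p.2)).
Proof.
move=> a0 b0 eta; have [->|eta0] := eqVneq eta 0; first by left.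
have [M M0 aM] := cvg0_bound _ a0; have [N N0 bN] := cvg0_bound _ b0.
pose d := `|eta| / 2; have d0 : 0 < d by rewrite divr_gt0 ?normr_gt0.
have [m _ am] := (cvgr0Pnorm_lt a).1 a0 _ (divr_gt0 d0 N0).
have [n _ bn] := (cvgr0Pnorm_lt b).1 b0 _ (divr_gt0 d0 M0).
pose K := (fun p : nat * nat => a p.1 * b p.2) @` (`I_m `*` `I_n).
have clK : closed (K `|` [set y | `|y| <= d]).
  apply: closedU.
    apply: (accessible_finite_set_closed.1 _ _ _).
      exact/hausdorff_accessible/norm_hausdorff.
    exact/finite_image/finite_setX.
  by apply: (closed_comp (f := fun y : R => `|y|) (D := [set y | y <= d])) => [y _|];
    [exact: norm_continuous|exact: closed_le].
move=> clE.
have /clK [[p _ <-]|] : closure (K `|` [set y | `|y| <= d]) eta.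
- apply: closure_subset clE => _ [->|[p _ <-]].
    by right; rewrite /= normr0 ltW.
  have [[p1 p2]|] := pselect (p.1 < m /\ p.2 < n)%N; first by left; exists p.
  move=> /not_andP[] /negP; rewrite -leqNgt => mp; right => /=; rewrite normrM.
    apply: le_trans (_ : d / N * N <= d); last by rewrite divfK ?gt_eqF.
    by rewrite ler_pM// ltW// am.
  apply: le_trans (_ : M * (d / M) <= d); last by rewrite mulrC divfK ?gt_eqF.
  by rewrite ler_pM// ltW// bn.
- by right; exists p.
- by rewrite /= /d; have := normr_gt0 eta; rewrite eta0; lra.
Qed.

End products.

(** * Cluster points of products perturbed by a sequence of finite range *)

Section perturbed_products.
Context {R : realType} {I : set (set nat)} (hI : is_ideal I).
Context {h k : nat -> nat} (hk : forall i l, ~ I [set n | h n = i /\ k n = l]).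
Context {a s x : nat -> R} {r : seq R} (sr : forall n, s n \in r).
Context {i : nat} (ai0 : a i != 0).

Lemma cluster_points_products (q : nat -> R) l :
  (forall n, x n = a (h n) * q (k n) + s n) ->
  exists2 v, v \in r & cluster_points I x (a i * q l + v).
Proof.
move=> xE; apply: (cluster_points_shift hI _ s _ _ _ (hk i l) sr).
by move=> n [hn kn]; rewrite xE hn kn.
Qed.

(** Upper bound: the cluster points lie in finitely many translates of the closed countable set [E],
    one for each value in [r]. *)
Lemma card_cluster_points_nat : a @ \oo --> 0 ->
  (forall n, x n = a (h n) * (k n).+1%:R^-1 + s n) ->
  (cluster_points I x #= [set: nat])%card.
Proof.
move=> a0 xE; rewrite card_eq_le; apply/andP; split.
  pose E : set R :=
    [set 0] `|` range (fun p : nat * nat => a p.1 * p.2.+1%:R^-1).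
  have clE : closed E by apply: (closed_products _ harmonic) => //; exact: cvg_harmonic.
  pose C := \bigcup_(v in [set` r]) [set y | E (y - v)].
  have clC : closed C.
    apply: closed_bigcup; first exact: finite_seq.
    move=> v _; apply: (closed_comp (f := fun y : R => y - v)) => // y _.
    by apply: cvgB; [exact: cvg_id|exact: cvg_cst].
  have GC : cluster_points I x `<=` C.
    apply: cluster_points_sub => // n; exists (s n); rewrite /= ?sr//.
    by right; exists (h n, k n); rewrite //= xE addrK.
  have EC : C `<=` (fun p => p.1 + p.2) @` (E `*` [set` r]).
    by move=> y [v vr Ey]; exists (y - v, v); rewrite //= subrK.
  apply: card_le_trans (subset_card_le GC) _.
  apply: card_le_trans (subset_card_le EC) _.
  apply: card_le_trans (card_image_le _ _) _.
  apply: countableX; last exact/finite_set_countable/finite_seq.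
  have : E `<=` range (oapp (fun p : nat * nat => a p.1 * p.2.+1%:R^-1) 0).
    by move=> _ [->|[p _ <-]]; [exists None|exists (Some p)].
  by move/subset_card_le/card_le_trans/(_ (card_image_le _ _))/sub_countable; apply.
apply/infiniteP => Gfin.
pose f l := a i * l.+1%:R^-1.
have f_inj : injective f.
  by move=> m n /(mulfI ai0)/invr_inj/eqP; rewrite eqr_nat eqSS => /eqP.
apply: infinite_nat; rewrite -(eq_finite_set (inj_card_eq (in2W f_inj))).
(* Each of the infinitely many values of [f] is a cluster point minus an element of [r], so finitely
   many cluster points would not suffice. *)
apply: sub_finite_set
  (finite_image (fun p => p.1 - p.2) (finite_setX Gfin (finite_seq r))).
move=> _ [l _ <-];
  have [v vr Gv] := cluster_points_products (fun l => l.+1%:R^-1) l xE.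
by exists (a i * l.+1%:R^-1 + v, v); rewrite //= addrK.
Qed.

(** The shift [v] may vary with the rational, so the closed sets [C v] only jointly contain the
    rationals of the interval. Their finite union is closed, hence covers the interval, and one
    [C v] contains a subinterval. *)
Lemma card_cluster_points_continuum (q : nat -> R) :
  (forall z : rat, `|ratr z : R| <= 1 -> exists l, q l = ratr z) ->
  (forall n, x n = a (h n) * q (k n) + s n) ->
  (cluster_points I x #= [set: R])%card.
Proof.
move=> q_rat xE; rewrite card_eq_le card_leT/=.
pose C v := [set t | cluster_points I x (a i * t + v)].
have clC v : closed (C v).
  apply: (closed_comp (f := fun t => a i * t + v)) => [t _|].
    by apply: cvgD; [apply: cvgMr; exact: cvg_id|exact: cvg_cst].
  exact: closed_cluster_points.
have clU : closed (\bigcup_(v in [set` r]) C v).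
  by apply: closed_bigcup; first exact: finite_seq.
have Cov t : -1 < t < 1 -> exists2 v, v \in r & C v t.
  move=> t1; suff [v vr Cvt] : (\bigcup_(v in [set` r]) C v) t by exists v.
  apply: clU => A /nbhs_ballP[e /= e0 eA].
  have /rat_in_itvoo[z] : Num.max (t - e) (-1) < Num.min (t + e) 1.
    by rewrite !lt_min !gt_max; lra.
  rewrite in_itv/= lt_min gt_max => z_itv.
  have [l ql] : exists l, q l = ratr z by apply: q_rat; rewrite ler_norml; lra.
  exists (q l); split.
    by have [v vr] := cluster_points_products q l xE; exists v.
  by apply: eA; rewrite -ball_normE/= ql ltr_norml; lra.
have [|v _ [c [d [cd CvE]]]] :=
  closed_cover_itv _ _ _ _ _ (fun v _ => clC v) Cov; first by lra.
apply: (itv_inj_card_le _ (fun t => a i * t + v) _ _ cd) CvE.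
by move=> t u /addIr/(mulfI ai0).
Qed.

End perturbed_products.

(** * An almost disjoint family from branches of the binary tree *)

Section almost_disjoint.
Implicit Type j : set nat * nat.

(** The set [j.1] is a branch of the binary tree, and [m] selects a node on it. The tag [j.2]
    provides countably many disjoint copies of the tree, one for each norm bound needed later. *)
Definition initial_code j m : nat :=
  pickle (j.2, mkseq (fun n => `[< j.1 n >]) m).

(* Distinct sets of codes have finite intersection. *)
Definition codes j : set nat := range (initial_code j).

(** A code determines its tag and its prefix, length included. Once the prefix covers a place [n]
    where the two sets differ, no coincidence is possible. *)
Lemma initial_code_eventually_notin j j' : j != j' ->
  exists N, forall m, (N <= m)%N -> ~ codes j (initial_code j' m).
Proof.
move: j j' => [A k] [A' k'] jj'.
have [kk'|kk'] := eqVneq k k'; last first.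
  by exists 0%N => m _ [m' _] /(pcan_inj pickleK)[] /eqP; rewrite (negbTE kk').
have [n An] : exists n, ~ (A n <-> A' n).
  apply/existsNP => AA'; move/eqP: jj'; apply; rewrite kk'; congr pair.
  exact/predeqP.
exists n.+1 => m nm [m' _] /(pcan_inj pickleK)[_ eqs]; apply: An.
have mm' : m' = m by have := congr1 size eqs; rewrite !size_mkseq.
have := congr1 (fun s => nth false s n) eqs.
by rewrite mm' !nth_mkseq//; exact: asbool_eq_equiv.
Qed.

(** This isolates one member of a finite subfamily, which is what linear independence requires. *)
Lemma initial_code_notin_codes (F : set (set nat * nat)) j : finite_set F ->
  exists m, forall j', F j' -> j' != j -> ~ codes j' (initial_code j m).
Proof.
move=> /finite_seqP[r ->].
suff [N rN] : exists N, forall m, (N <= m)%N ->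
    forall j', j' \in r -> j' != j -> ~ codes j' (initial_code j m).
  by exists N => j'; exact: rN.
elim: r => [|j' r [N rN]]; first by exists 0%N.
have [->|j'j] := eqVneq j' j.
  exists N => m Nm i; rewrite inE => /orP[/eqP ->|]; last exact: rN.
  by rewrite eqxx.
have [N' j'N] := initial_code_eventually_notin _ _ j'j.
exists (maxn N N') => m; rewrite geq_max => /andP[Nm N'm] i.
rewrite inE => /orP[/eqP -> _|]; [exact: j'N|exact: rN].
Qed.

End almost_disjoint.

(** * The closed infinite-dimensional subspace of products *)

Section sequence_spaces.
Context {R : realType} {I : set (set nat)} (hI : is_ideal I).
Context {h k : nat -> nat} (hk : forall i l, ~ I [set n | h n = i /\ k n = l]).
Context {q : nat -> R} (q_le1 : forall l, `|q l| <= 1).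
Context {l0 : nat} (ql0 : q l0 = 1).
Implicit Types (x y : linf R) (a : nat -> R).

Definition product_space : set (linf R) :=
  [set x | exists2 a : nat -> R, a @ \oo --> 0 & forall n, x n = a (h n) * q (k n)].

(** Since [q l0 = 1], evaluation at [m i] reads off the coefficient [a i] of an element of
    [product_space]. The fibers are nonempty because the empty set is in [I]. *)
Lemma exists_fiber_elt : exists m : nat -> nat, forall i, h (m i) = i /\ k (m i) = l0.
Proof.
suff /boolp.choice[m hkm] : forall i, exists n, h n = i /\ k n = l0 by exists m.
move=> i.
apply: contrapT => noi; apply: (hk i l0); apply: (ideal_sub hI) (ideal_set0 hI).
by move=> n hkn; apply: noi; exists n.
Qed.

Lemma exists_linf (u : nat -> R) (M : R) : (forall n, `|u n| <= M) ->
  exists x : linf R, forall n, x n = u n.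
Proof.
move=> uM; have ub : u \in bounded_seq by apply/bounded_seqP; exists M.
by exists (Linf ub).
Qed.

Lemma linf_norm_le x (M : R) : (forall n, `|x n| <= M) -> `|x| <= M.
Proof. exact: sup_norm_le. Qed.

Lemma ler_linf_norm x n : `|x n| <= `|x|.
Proof. exact: le_sup_norm. Qed.

Lemma linf_fsum {T : choiceType} (F : set T) (f : T -> linf R) n :
  finite_set F -> (\sum_(j \in F) f j) n = \sum_(j \in F) f j n.
Proof.
move=> Ff; rewrite !fsbig_finite//.
exact: (big_morph (fun x : linf R => x n)).
Qed.

Lemma normr_product_le a n : `|a (h n) * q (k n)| <= `|a (h n)|.
Proof. by rewrite normrM ler_piMr. Qed.

Lemma exists_product_space a : a @ \oo --> 0 ->
  exists2 x, product_space x & forall n, x n = a (h n) * q (k n).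
Proof.
move=> a0; have [M _ aM] := cvg0_bound _ a0.
have [|x xE] := exists_linf (fun n => a (h n) * q (k n)) M;
  last by exists x => //; exists a.
by move=> n; exact: le_trans (normr_product_le _ _) _.
Qed.

Lemma submod_closed_product_space : submod_closed (mem product_space).
Proof.
split=> [|c x y]; rewrite ?inE.
  by exists (cst 0) => [|n]; [exact: cvg_cst|rewrite /cst mul0r].
move=> [a a0 xE] [b b0 yE]; exists (fun n => c * a n + b n) => [|n].
  rewrite -[0]addr0 -[X in X + _](mulr0 c).
  by apply: cvgD => //; exact: cvgMr.
by rewrite mulrDl -mulrA -xE -yE.
Qed.

(** The coefficients of a limit [x] can only be [x \o m]. They are uniformly approximated by null
    sequences, hence null. *)
Lemma closed_product_space : closed product_space.
Proof.
have [m hkm] := exists_fiber_elt.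
move=> x clx.
have approx (e : R) : 0 < e -> exists2 a : nat -> R, a @ \oo --> 0 &
    forall n, `|x n - a (h n) * q (k n)| < e.
  move=> e0; have [y [[a a0 yE]]] := clx _ (nbhsx_ballx x _ e0).
  rewrite -ball_normE/= => xy; exists a => // n.
  by rewrite -yE (le_lt_trans (ler_linf_norm (x - y) n)).
have approxm a (e : R) i : (forall n, `|x n - a (h n) * q (k n)| < e) ->
    `|x (m i) - a i| < e.
  by move=> /(_ (m i)); have [-> ->] := hkm i; rewrite ql0 mulr1.
exists (x \o m) => [|n] /=.
  apply/cvgr0Pnorm_lt => e e0.
  have e2 : 0 < e / 2 by lra.
  have [a a0 /approxm xa] := approx _ e2.
  near=> i; rewrite /= -(subrK (a i) (x (m i))) (le_lt_trans (ler_normD _ _))//.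
  have : `|a i| < e / 2 by near: i; exact: (cvgr0Pnorm_lt _).1.
  by have := xa i; lra.
apply/eqP; rewrite -subr_eq0 -normr_le0; apply/ler_addgt0Pr => e e0.
have e2 : 0 < e / 2 by lra.
have [a a0 xa] := approx _ e2.
have := xa n; have := approxm _ _ (h n) xa.
set y := x (m _) => ya.
(* Both differences are below [e / 2]: the first by the approximation at [n], the second by the
   approximation at [m (h n)], as [|q| <= 1]. *)
have -> : x n - y * q (k n) =
    (x n - a (h n) * q (k n)) - (y - a (h n)) * q (k n) by ring.
have : `|(y - a (h n)) * q (k n)| <= `|y - a (h n)| by rewrite normrM ler_piMr.
move=> h1 h2; rewrite add0r (le_trans (ler_normB _ _))//; lra.
Unshelve. all: by end_near. Qed.

(** With [d] spanning vectors, evaluating the elements with unit coefficient sequences at the points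
    [m j] would factor the identity matrix of size [d.+1] through dimension [d]. *)
Lemma product_space_infinite_dimensional : ~ finite_dimensional product_space.
Proof.
have [m hkm] := exists_fiber_elt.
move=> [d [b bE]].
have spanned (i : 'I_d.+1) : exists c : 'I_d -> R,
    forall j : 'I_d.+1, \sum_l c l * b l (m j) = (i == j)%:R.
  have [|x] := exists_product_space (fun n => (n == i)%:R).
    apply: cvg_near_cst; exists i.+1 => // n /= ni.
    by rewrite gtn_eqF.
  rewrite bE => -[c ->] xE; exists c => j.
  have := xE (m j); have [-> ->] := hkm j.
  rewrite ql0 mulr1 eq_sym => <-.
  by rewrite (big_morph (fun x : linf R => x (m j)) (id1 := 0) (op1 := +%R)).
have [C CE] := boolp.choice spanned.
suff /mulmx1_min : (\matrix_(i, l) C i l) *m (\matrix_(l, j) b l (m j)) = 1%:M.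
  by rewrite ltnn.
apply/matrixP => i j; rewrite !mxE -CE.
by apply: eq_bigr => l _; rewrite !mxE.
Qed.

Lemma spaceable_of_product_space (M : set (linf R)) :
  (forall x, product_space x -> x != 0 -> M x) -> spaceable M.
Proof.
move=> PM; exists product_space; split.
- exact: submod_closed_product_space.
- exact: closed_product_space.
- exact: product_space_infinite_dimensional.
- by move=> x Px; have [->|x0] := eqVneq x 0; [right|left; exact: PM].
Qed.

(** * A dense span of perturbed indicator functions *)

Section dense_lineability.
Context {M : set (linf R)}.
Hypothesis hM : forall w s : linf R, product_space w -> w != 0 ->
  finite_set (range s) -> M (w + s).

Lemma exists_indic_linf (A : set nat) : exists e : linf R, forall n, e n = \1_A n.
Proof.
by apply: (exists_linf _ 1) => n; rewrite indicE normr_nat lern1 leq_b1.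
Qed.

(** The first factor controls the norm, the second makes the sequence null, and the indicator yields
    linear independence. *)
Definition code_seq (j : set nat * nat) (i : nat) : R :=
  j.2.+1%:R^-1 * i.+1%:R^-1 * \1_(codes j) i.

Lemma cvg_code_seq j : code_seq j @ \oo --> 0.
Proof.
apply/cvgr0Pnorm_lt => e e0.
have small := (cvgr0Pnorm_lt (harmonic : nat -> R)).1 (@cvg_harmonic R) _ e0.
near=> i; have : `|harmonic i| < e by near: i; exact: small.
apply: le_lt_trans; rewrite /code_seq mulrAC normrM ler_piMl//.
rewrite normrM indicE normr_nat normfV normr_nat mulr_ile1 ?lern1 ?leq_b1//.
by rewrite invf_le1 ?ler1n.
Unshelve. all: by end_near. Qed.

Lemma exists_code_linf j : exists w : linf R,
  product_space w /\ forall n, w n = code_seq j (h n) * q (k n).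
Proof. by have [w Pw wE] := exists_product_space _ (cvg_code_seq j); exists w. Qed.

Lemma code_seq_le j i : `|code_seq j i| <= j.2.+1%:R^-1.
Proof.
rewrite /code_seq -mulrA normrM normfV normr_nat ler_piMr//.
rewrite normrM indicE normr_nat normfV normr_nat mulr_ile1 ?lern1 ?leq_b1//.
by rewrite invf_le1 ?ler1n.
Qed.

(** At a suitable code on the branch [j], every other term of the sum vanishes. *)
Lemma code_seq_sum_neq0 (F : set (set nat * nat)) (c : set nat * nat -> R) j :
  finite_set F -> F j -> c j != 0 ->
  exists i, \sum_(j' \in F) c j' * code_seq j' i != 0.
Proof.
move=> Ff Fj cj; have [m jm] := initial_code_notin_codes _ j Ff.
exists (initial_code j m).
rewrite (fsbigD1 j)//= fsbig1 => [|j' [Fj' /= /eqP j'j]].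
  rewrite addr0 /code_seq indicE mem_set; last by exists m.
  by rewrite mulr1 !mulf_neq0 ?invr_neq0 ?pnatr_eq0.
by rewrite /code_seq indicE memNset ?mulr0//; exact: jm.
Qed.

Lemma finite_range_sum {T : choiceType} (F : set T) (f : T -> linf R) :
  finite_set F -> (forall j, F j -> finite_set (range (f j))) ->
  finite_set (range (\sum_(j \in F) f j : linf R)).
Proof.
move=> Ff fF; rewrite fsbig_finite// big_seq.
apply: (big_ind (fun x : linf R => finite_set (range x))).
- by apply: sub_finite_set (finite_set1 0) => _ [n _ <-].
- move=> x y xf yf.
  apply: sub_finite_set (finite_image2 +%R xf yf) => _ [n _ <-].
  by exists (x n); [exists n|exists (y n); [exists n|]].
- by move=> j; rewrite in_fset_set// inE => /fF.
Qed.

Lemma product_space_sum {T : choiceType} (F : set T) (f : T -> linf R) :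
  finite_set F -> (forall j, F j -> product_space (f j)) ->
  product_space (\sum_(j \in F) f j).
Proof.
move=> Ff fF; rewrite fsbig_finite// big_seq.
have [P0 PD] := submod_closed_product_space.
apply: big_ind.
- by have := P0; rewrite inE.
- by move=> x y Px Py; have := PD 1 x y; rewrite !inE scale1r; apply.
- by move=> j; rewrite in_fset_set// inE => /fF.
Qed.

(** Requiring [c] to vanish off [F] lets two combinations be added over the union of their
    supports. *)
Definition span_family {T : choiceType} (u : T -> linf R) : set (linf R) :=
  [set v | exists (F : set T) (c : T -> R), [/\ finite_set F,
     forall j, ~ F j -> c j = 0 & v = \sum_(j \in F) c j *: u j]].

Lemma submod_closed_span_family {T : choiceType} (u : T -> linf R) :
  submod_closed (mem (span_family u)).
Proof.
split=> [|a x y]; rewrite ?inE.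
  by exists set0, (cst 0); split; [exact: finite_set0| |rewrite fsbig_set0].
move=> [F [c [Ff cF ->]]] [G [d [Gf dG ->]]].
have FGf : finite_set (F `|` G) by rewrite finite_setU.
exists (F `|` G), (fun j => a * c j + d j); split=> //.
  by move=> j /not_orP[/cF -> /dG ->]; rewrite mulr0 addr0.
rewrite (fsbig_widen F (F `|` G)); [|exact: subsetUl|]; last first.
  by move=> j [_ /cF cj]; rewrite /preimage/= cj scale0r.
rewrite (fsbig_widen G (F `|` G)); [|exact: subsetUr|]; last first.
  by move=> j [_ /dG dj]; rewrite /preimage/= dj scale0r.
rewrite !fsbig_finite// scaler_sumr -big_split/=.
by apply: eq_bigr => j _; rewrite scalerDl scalerA.
Qed.

Lemma mem_span_family {T : choiceType} (u : T -> linf R) j : span_family u (u j).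
Proof.
exists [set j], (fun i => (i == j)%:R); split; first exact: finite_set1.
  by move=> i /= /eqP/negbTE ->.
by rewrite fsbig_set1 eqxx scale1r.
Qed.

(* Layer-cake approximation by multiples of indicator functions. *)
Lemma dense_of_indic_closure (V : set (linf R)) : submod_closed (mem V) ->
  (forall (A : set nat) (e : R), 0 < e ->
     exists2 v, V v & forall n, `|\1_A n - v n| <= e) ->
  dense V.
Proof.
move=> [V0 VD] V1.
(* [P] is membership in the uniform closure of [V]; arbitrary functions are allowed so that
   indicators need no bundling. *)
pose P (x : nat -> R) := forall e : R, 0 < e ->
  exists2 v, V v & forall n, `|x n - v n| <= e.
have PD (x y : nat -> R) (c : R) : P x -> P y -> P (fun n => c * x n + y n).
  move=> Px Py e e0; pose d := e / (`|c| + 1).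
  have c0 := normr_ge0 c; have c1 : 0 < `|c| + 1 by lra.
  have d0 : 0 < d by rewrite divr_gt0.
  have [v Vv xv] := Px _ d0; have [w Vw yw] := Py _ d0.
  exists (c *: v + w) => [|n]; first by have := VD c v w; rewrite !inE; apply.
  have -> : c * x n + y n - (c *: v + w) n = c * (x n - v n) + (y n - w n).
    have -> : (c *: v + w) n = c * v n + w n by [].
    by ring.
  have eE : e = `|c| * d + d by rewrite /d; field; rewrite gt_eqF.
  rewrite eE (le_trans (ler_normD _ _))// lerD// normrM.
  exact: ler_wpM2l.
have layers (d : R) K (x : nat -> R) : 0 < d ->
    (forall n, 0 <= x n <= d *+ K.+1) ->
    exists2 y, P y & forall n, `|x n - y n| <= d.
  move=> d0; elim: K x => [|K IH] x xd.
    exists (fun=> 0) => [e e0|n].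
      exists 0 => [|n]; first by have := V0; rewrite inE.
      by rewrite subrr normr0 ltW.
    by have /andP[x0 x1] := xd n; rewrite subr0 ger0_norm.
  (* Subtracting [d] on [A] keeps the values nonnegative and lowers the upper bound by one layer. *)
  pose A := [set n | d < x n].
  have [|y Py xy] := IH (fun n => x n - d * \1_A n).
    move=> n; have := xd n; rewrite indicE mulrS.
    have [nA|nA] := boolP (n \in A).
      by move: nA; rewrite inE /A/= => nA; lra.
    have {}nA : x n <= d.
      by rewrite leNgt; apply/negP => ?; move/negP: nA; rewrite inE.
    have : 0 <= d *+ K by rewrite mulrn_wge0// ltW.
    by rewrite mulrS mulr0n mulr0; lra.
  exists (fun n => d * \1_A n + y n); first exact: PD (V1 A) Py.
  by move=> n; rewrite opprD addrA.
have Pall (x : linf R) : P x.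
  move=> e e0; have e2 : 0 < e / 2 by lra.
  (* Adding the constant [|x|] makes the sequence nonnegative; the indicator of the full set undoes
     this shift below. *)
  have [K xK] : exists K, forall n, 0 <= x n + `|x| <= (e / 2) *+ K.+1.
    exists (Num.bound ((`|x| + `|x|) / (e / 2))) => n.
    have := ler_linf_norm x n; rewrite ler_norml => xn.
    have D0 : 0 <= (`|x| + `|x|) / (e / 2) by rewrite divr_ge0 ?addr_ge0// ltW.
    have := archi_boundP D0; rewrite ltr_pdivrMr// mulr_natl => xb; rewrite mulrS.
    by apply/andP; split; lra.
  have [y Py xy] := layers _ _ _ e2 xK.
  have P1 : P (\1_setT) by move=> d; exact: V1.
  have [v Vv yv] := PD _ _ (- `|x|) P1 Py _ e2.
  exists v => // n; have := xy n; have := yv n; rewrite indicE in_setT mulr1.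
  by rewrite !ler_norml; lra.
move=> O [x Ox]; rewrite openE => /(_ x Ox) /nbhs_ballP[e /= e0 eO].
have e2 : 0 < e / 2 by lra.
have [v Vv xv] := Pall x _ e2.
exists v; split=> //; apply: eO; rewrite -ball_normE/=.
by apply: (le_lt_trans (linf_norm_le (x - v) (e / 2) xv)); lra.
Qed.

Lemma densely_lineable_of_product_space : densely_lineable M.
Proof.
have [e eE] := boolp.choice exists_indic_linf.
have [w wE] := boolp.choice exists_code_linf.
(* The set [j.1] serves twice: it selects the branch behind [w j] and the indicator to be
   approximated. *)
pose u j := w j + e j.1.
exists (span_family u); split.
- exact: submod_closed_span_family.
- apply: dense_of_indic_closure; first exact: submod_closed_span_family.
  move=> A d d0.
  have [n _ /(_ n (leqnn n)) nd] := near_infty_natSinv_lt (PosNum d0).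
  exists (u (A, n)); first exact: mem_span_family.
  move=> i; have -> : u (A, n) i = w (A, n) i + \1_A i by rewrite -eE.
  rewrite opprD addrCA subrr addr0 normrN (wE (A, n)).2.
  rewrite (le_trans (normr_product_le _ _))// (le_trans (code_seq_le _ _))//.
  exact: ltW.
- move=> _ [F [c [Ff cF ->]]].
  have [c0|/existsNP[j /not_implyP[Fj /eqP cj]]] :=
      pselect (forall j, F j -> c j = 0).
    by right; rewrite /= fsbig1// => j /c0 ->; rewrite scale0r.
  left; have -> : \sum_(j \in F) c j *: u j =
      \sum_(j \in F) c j *: w j + \sum_(j \in F) c j *: e j.1.
    by rewrite -fsbig_split//; apply: eq_fsbigr => i _; rewrite scalerDr.
  have PZ i : product_space (c i *: w i).
    have [P0 PD] := submod_closed_product_space.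
    have := PD (c i) (w i) 0; rewrite !inE addr0; apply; last by have := P0; rewrite inE.
    exact: (wE i).1.
  apply: hM.
  + exact: product_space_sum.
  (* If the part in [product_space] were zero, its value at [m i] would make the [i]-th coefficient
     sum vanish. *)
  + have [i si] := code_seq_sum_neq0 _ _ _ Ff Fj cj.
    have [m hkm] := exists_fiber_elt; have [hi ki] := hkm i.
    apply: contra_neq si => /(congr1 (fun x : linf R => x (m i))).
    rewrite linf_fsum// => sw0; rewrite -[RHS]sw0; apply: eq_fsbigr => j' _.
    have -> : (c j' *: w j') (m i) = c j' * w j' (m i) by [].
    by rewrite (wE j').2 hi ki ql0 mulr1.
  + apply: finite_range_sum => // i _.
    apply: sub_finite_set (finite_set2 0 (c i)) => _ [n _ <-].
    have -> : (c i *: e i.1) n = c i * \1_(i.1) n by rewrite -eE.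
    by rewrite indicE; case: (n \in i.1); rewrite ?mulr0 ?mulr1; [right|left].
Qed.

End dense_lineability.
End sequence_spaces.

(** * Positive fibers indexed by pairs, and the conclusion *)

Lemma exists_double_fibers {I : set (set nat)} (hI : is_ideal I)
    (B : nat -> set nat) : trivIset [set: nat] B -> (forall j, ~ I (B j)) ->
  exists h k : nat -> nat, forall i l, ~ I [set n | h n = i /\ k n = l].
Proof.
move=> tB nIB.
(* Points in no [B i] receive the default index [0], which only enlarges a fiber. *)
have /boolp.choice[g gE] : forall n, exists j, forall i, B i n -> i = j.
  move=> n; have [[i Bin]|nB] := pselect (exists i, B i n); last first.
    by exists 0%N => i Bin; exfalso; apply: nB; exists i.
  by exists i => j Bjn; apply: tB => //; exists n.
pose p n : nat * nat := odflt (0, 0)%N (unpickle (g n)).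
exists (fst \o p), (snd \o p) => i l.
(* The fiber over [(i, l)] contains the member of [B] indexed by the code of this pair. *)
apply: contra_not (nIB (pickle (i, l))); apply: (ideal_sub hI) => n Bn /=.
by rewrite /p -(gE _ _ Bn) pickleK.
Qed.

Theorem mainTheorem9 (R : realType) (I : set (set nat)) (hI : is_ideal I)
    (hB : exists B : nat -> set nat,
        trivIset [set: nat] B /\ forall j, ~ I (B j)) :
  (densely_lineable (Gamma R I [set: nat]) /\
   densely_lineable (Gamma R I [set: R])) /\
  (spaceable (Gamma R I [set: nat]) /\
   spaceable (Gamma R I [set: R])).
Proof.
have [B [tB nIB]] := hB.
have [h [k hk]] := exists_double_fibers hI _ tB nIB.
pose q1 (l : nat) : R := l.+1%:R^-1.
have q1_le l : `|q1 l| <= 1 by rewrite normfV normr_nat invf_le1 ?ler1n.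
have q1_0 : q1 0%N = 1 by rewrite /q1 invr1.
(* Numbers that code no rational, or one outside [[-1, 1]], are sent to [0], so [q2] stays bounded
   by 1. *)
pose q2 (l : nat) : R :=
  let z : R := ratr (odflt 0 (unpickle l)) in if `|z| <= 1 then z else 0.
have q2_le l : `|q2 l| <= 1 by rewrite /q2; case: ifP => //; rewrite normr0.
have q2_rat (z : rat) : `|ratr z : R| <= 1 -> exists l, q2 l = ratr z.
  by move=> z1; exists (pickle z); rewrite /q2 pickleK/= z1.
have [l2 q2_1] : exists l, q2 l = 1.
  by have [|l] := q2_rat 1; rewrite rmorph1 ?normr1//; exists l.
have neq0 q (w : linf R) a : w != 0 -> (forall n, w n = a (h n) * q (k n)) ->
    exists i, a i != 0.
  move=> w0 wE; apply: contrapT => /forallNP a0; move/eqP: w0; apply.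
  apply/val_inj/funext => n; rewrite [LHS]wE.
  by have /negP/negPn/eqP -> := a0 (h n); rewrite mul0r.
have G1 (w s : linf R) : product_space (h := h) (k := k) (q := q1) w -> w != 0 ->
    finite_set (range s) -> Gamma R I [set: nat] (w + s).
  move=> [a a0 wE] w0 /finite_seqP[r rE].
  have [i ai0] := neq0 _ _ _ w0 wE.
  have sr n : s n \in r by have : range s (s n) by []; rewrite rE.
  by apply: (card_cluster_points_nat hI hk sr ai0 a0) => n; rewrite -wE.
have G2 (w s : linf R) : product_space (h := h) (k := k) (q := q2) w -> w != 0 ->
    finite_set (range s) -> Gamma R I [set: R] (w + s).
  move=> [a a0 wE] w0 /finite_seqP[r rE].
  have [i ai0] := neq0 _ _ _ w0 wE.
  have sr n : s n \in r by have : range s (s n) by []; rewrite rE.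
  by apply: (card_cluster_points_continuum hI hk sr ai0 q2 q2_rat) => n; rewrite -wE.
have range0 : finite_set (range (0 : linf R)).
  by apply: sub_finite_set (finite_set1 0) => _ [n _ <-].
split; split.
- exact: (densely_lineable_of_product_space hI hk q1_le q1_0).
- exact: (densely_lineable_of_product_space hI hk q2_le q2_1).
(* Spaceability is the case of the zero perturbation. *)
- apply: (spaceable_of_product_space hI hk q1_le q1_0) => x Px x0.
  by rewrite -[x]addr0; exact: G1.
- apply: (spaceable_of_product_space hI hk q2_le q2_1) => x Px x0.
  by rewrite -[x]addr0; exact: G2.
Qed.
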